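(* A graph $G$ is $\gamma_g'$-perfect if and only if it is a disjoint union of cliques (i.e. every connected component of $G$ is a complete graph).
   Context: Graphs are finite, simple, undirected, with at least one vertex, not necessarily connected. $\gamma(G)$ is the domination number of $G$. Domination game on $G$: Dominator and Staller alternately select vertices; each selected vertex must dominate (i.e. contain in its closed neighborhood) at least one vertex not dominated by the previously selected vertices. The game ends when no legal move exists. Dominator wants to minimize and Staller to maximize the total number of moves. $\gamma_g'(G)$ is the number of moves under optimal play when Staller starts. $G$ is $\gamma_g'$-perfect if every induced subgraph $F$ of $G$ satisfies $\gamma_g'(F)=\gamma(F)$. *)

(* Defs.v *)
From mathcomp Require Import all_boot.
Set Implicit Arguments.
Unset Strict Implicit.
Unset Printing Implicit Defensive.

(* Finite simple undirected graphs. Nonemptiness is not built in: it is a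
   hypothesis wherever a graph is quantified over. *)
Record sgraph := SGraph {
  vertex :> finType;
  adj : rel vertex;
  adj_sym : symmetric adj;
  adj_irr : irreflexive adj
}.

Section Graph.
Variable G : sgraph.
Implicit Types (S A D : {set G}) (v : G).

Definition closed_nbh v : {set G} := [set u | (u == v) || adj v u].

Definition dominated S : {set G} := \bigcup_(v in S) closed_nbh v.

Definition dominating D : bool := dominated D == [set: G].

Definition gamma : nat := #|[arg min_(D < [set: G] | dominating D) #|D| ]|.

Definition complete : Prop := forall x y : G, x != y -> adj x y.

Definition component v : {set G} := [set u | connect (@adj G) v u].

Section Induced.
Variable A : {set G}.

Definition induced_adj : rel {x : G | x \in A} :=
  fun x y => adj (val x) (val y).

Lemma induced_adj_sym : symmetric induced_adj.
Proof. by move=> x y; apply: adj_sym. Qed.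

Lemma induced_adj_irr : irreflexive induced_adj.
Proof. by move=> x; apply: adj_irr. Qed.

Definition induced : sgraph := SGraph induced_adj_sym induced_adj_irr.
End Induced.

End Graph.

Inductive player := Dominator | Staller.

Definition opponent (p : player) : player :=
  if p is Dominator then Staller else Dominator.

Section Game.
Variable G : sgraph.
Implicit Types (S : {set G}) (p : player) (v : G).

(* S is the set of previously selected vertices. *)
Definition legal S v : bool := ~~ (closed_nbh v \subset dominated S).

(* Number of moves still to be played under optimal play from S, with p to
   move. The fuel n bounds the number of remaining moves; it is also the
   default value of the minimum, which is harmless as every value with fuel n
   is at most n. The equation without fuel is moves_leftE. *)
Fixpoint moves_within (n : nat) p S : nat :=
  if n is n'.+1 then
    if [exists v, legal S v] then
      if p is Dominator
      then (\big[minn/n']_(v | legal S v)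
              moves_within n' (opponent p) (v |: S)).+1
      else (\max_(v | legal S v)
              moves_within n' (opponent p) (v |: S)).+1
    else 0
  else 0.

(* A selected vertex is never legal again, so #|~: S| is enough fuel. *)
Definition moves_left p S : nat := moves_within #|~: S| p S.

Lemma legal_notin S v : legal S v -> v \notin S.
Proof. by apply: contra => vS; rewrite /dominated (bigcup_sup v). Qed.

Lemma moves_within_le n p S : moves_within n p S <= n.
Proof.
elim: n p S => [|n IHn] p S //=.
case: existsP => [[v Lv]|] //; case: p; rewrite ltnS.
  by apply: (big_ind (fun a => a <= n)) => // a b ha hb; rewrite geq_min ha.
by apply/bigmax_leqP.
Qed.

Lemma bigmin_default (P : pred G) (F : G -> nat) w m n :
  P w -> F w <= m -> F w <= n ->
  \big[minn/m]_(v | P v) F v = \big[minn/n]_(v | P v) F v.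
Proof.
move=> Pw Fm Fn.
have le_w k : \big[minn/k]_(v | P v) F v <= F w.
  have := mem_index_enum w; elim: (index_enum _) => //= a r IHr.
  rewrite inE big_cons => /predU1P[<-|/IHr le_r].
    by rewrite Pw geq_minl.
  by case: ifP => // _; rewrite geq_min le_r orbT.
rewrite -(minn_idPr (le_w m)) -(minn_idPr (le_w n)).
apply: (big_ind2 (fun a b => minn (F w) a = minn (F w) b)) => //.
  by rewrite (minn_idPl Fm) (minn_idPl Fn).
by move=> a b c d ab cd; rewrite minnA ab minnAC cd minnAC minnA.
Qed.

Lemma moves_leftE p S :
  moves_left p S =
    if [exists v, legal S v] then
      if p is Dominator
      then (\big[minn/#|G|]_(v | legal S v) moves_left Staller (v |: S)).+1
      else (\max_(v | legal S v) moves_left Dominator (v |: S)).+1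
    else 0.
Proof.
have cardS v : legal S v -> #|~: S| = #|~: (v |: S)|.+1.
  move=> /legal_notin vS; rewrite (cardsD1 v) in_setC vS add1n.
  by congr _.+1; apply: eq_card => u; rewrite !inE negb_or.
rewrite /moves_left.
case: existsP => [[w Lw]|nL]; last first.
  by case: #|~: S| => //= n; case: existsP.
rewrite (cardS _ Lw) /= ifT; last by apply/existsP; exists w.
have fuel v : legal S v -> #|~: (v |: S)| = #|~: (w |: S)|.
  by move=> Lv; apply: succn_inj; rewrite -!cardS.
case: p; congr _.+1; last by apply: eq_bigr => v /fuel ->.
set F := fun v => moves_within #|~: (v |: S)| Staller (v |: S).
rewrite (eq_bigr F) => [|v Lv]; last by rewrite /F fuel.
apply: (bigmin_default Lw).
  by rewrite /F moves_within_le.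
by rewrite /F (leq_trans (moves_within_le _ _ _)) ?fuel ?max_card.
Qed.

(* Staller-start game domination number. *)
Definition gamma_g' : nat := moves_left Staller set0.

End Game.

Definition gamma_g'_perfect (G : sgraph) : Prop :=
  forall A : {set G}, A != set0 -> gamma_g' (induced A) = gamma (induced A).

Definition disjoint_union_of_cliques (G : sgraph) : Prop :=
  forall v : G, complete (induced (component v)).

(* Main.v *)
(* A graph is a disjoint union of cliques exactly when membership in closed
   neighborhoods is transitive, i.e. when there is no induced path on three
   vertices. On such a path one vertex dominates, but Staller prolongs the game
   to two moves by starting at an end vertex. Conversely, in a disjoint union
   of cliques every legal move dominates exactly one new clique, so any play
   whatsoever takes as many moves as there are cliques, which is also the
   domination number. *)
Require Import Defs.
From mathcomp Require Import all_boot.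

Set Implicit Arguments.
Unset Strict Implicit.
Unset Printing Implicit Defensive.

Definition nbh_transitive (G : sgraph) : Prop :=
  forall u v w : G,
    v \in closed_nbh u -> w \in closed_nbh v -> w \in closed_nbh u.

Section Neighborhoods.
Variable G : sgraph.
Implicit Types (S D : {set G}) (u v w : G).

Lemma closed_nbh_refl v : v \in closed_nbh v.
Proof. by rewrite inE eqxx. Qed.

Lemma closed_nbh_sym u v : (u \in closed_nbh v) = (v \in closed_nbh u).
Proof. by rewrite !inE eq_sym adj_sym. Qed.

Lemma dominatedP S v :
  reflect (exists2 u, u \in S & v \in closed_nbh u) (v \in dominated S).
Proof. exact: bigcupP. Qed.

Lemma dominatedU1 v S : dominated (v |: S) = closed_nbh v :|: dominated S.
Proof. by rewrite /dominated bigcup_setU big_set1. Qed.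

Lemma dominating_setT : @dominating G [set: G].
Proof.
apply/eqP/setP=> v; rewrite in_setT; apply/dominatedP.
by exists v; rewrite ?in_setT ?closed_nbh_refl.
Qed.

Lemma gamma_le D : @dominating G D -> gamma G <= #|D|.
Proof.
rewrite /gamma; case: arg_minnP => [|D0 _ minD0]; last exact: minD0.
exact: dominating_setT.
Qed.

Lemma gamma_attained : exists2 D, @dominating G D & gamma G = #|D|.
Proof.
rewrite /gamma; case: arg_minnP => [|D domD _]; first exact: dominating_setT.
by exists D.
Qed.

Lemma nbh_transitiveP : disjoint_union_of_cliques G <-> nbh_transitive G.
Proof.
split=> [cliques u v w uv vw | trG v x y xy].
  have connect_nbh a b : b \in closed_nbh a -> connect (@adj G) a b.
    by rewrite inE => /predU1P[->|/connect1].
  have compu : u \in component u by rewrite inE connect0.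
  have compw : w \in component u.
    by rewrite inE (connect_trans (connect_nbh _ _ uv)) ?connect_nbh.
  rewrite inE; case: eqVneq => //= wu.
  by apply: (cliques u (exist _ u compu) (exist _ w compw)); rewrite eq_sym.
(* By transitivity a whole path collapses to a single step, so both [val x] and [val y] lie in the
   closed neighborhood of [v]. *)
have connect_nbh a b : connect (@adj G) a b -> b \in closed_nbh a.
  case/connectP=> p; elim: p a => [|c p IHp] a /=.
    by move=> _ ->; apply: closed_nbh_refl.
  case/andP=> ac /IHp cp /cp; apply: trG.
  by rewrite inE ac orbT.
have: val y \in closed_nbh (val x).
  have /connect_nbh := etrans (esym (in_set _ _)) (valP x).
  rewrite closed_nbh_sym => /trG; apply.
  exact: connect_nbh (etrans (esym (in_set _ _)) (valP y)).
by rewrite inE val_eqE eq_sym (negPf xy).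
Qed.

End Neighborhoods.

Lemma induced_closed_nbh (G : sgraph) (A : {set G}) (u v : induced A) :
  (v \in closed_nbh u) = (val v \in closed_nbh (val u)).
Proof. by rewrite !inE val_eqE. Qed.

Lemma induced_nbh_transitive (G : sgraph) (A : {set G}) :
  nbh_transitive G -> nbh_transitive (induced A).
Proof. by move=> trG u v w; rewrite !induced_closed_nbh; apply: trG. Qed.

Section Moves.
Variable G : sgraph.
Implicit Types (S : {set G}) (p : player) (u v : G).

(** When all legal moves lead to the same value, minimum and maximum agree, so the two players need
    no separate treatment. *)
Lemma moves_left_const p S v k : k <= #|G| -> legal S v ->
  (forall u, legal S u -> moves_left (opponent p) (u |: S) = k) ->
  moves_left p S = k.+1.
Proof.
move=> kG Lv movesk; rewrite moves_leftE ifT; last by apply/existsP; exists v.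
case: p movesk => /= movesk; congr _.+1.
  (* The default [#|G|] is exchanged for [k], by [k <= #|G|]; then every argument of the minimum,
     default included, equals [k]. *)
  rewrite (bigmin_default (n := k) Lv) ?movesk //.
  by apply: (big_ind (eq^~ k)) => // a b -> ->; rewrite minnn.
apply/eqP; rewrite eqn_leq; apply/andP; split.
  by apply/bigmax_leqP => u /movesk ->.
by rewrite -(movesk v Lv) (leq_bigmax_cond _ Lv).
Qed.

Lemma undominated_legal S v : v \notin dominated S -> legal S v.
Proof. by move=> vS; apply/subsetPn; exists v; first exact: closed_nbh_refl. Qed.

(** Staller can open at [u]; [v] is then still undominated, so a reply exists. *)
Lemma gamma_g'_gt1 u v : v \notin closed_nbh u -> 1 < gamma_g' G.
Proof.
move=> uv; have Lu : legal set0 u.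
  by apply: undominated_legal; rewrite /dominated big_set0 in_set0.
rewrite /gamma_g' moves_leftE ifT; last by apply/existsP; exists u.
rewrite ltnS; apply: leq_trans (leq_bigmax_cond _ Lu).
rewrite moves_leftE ifT //; apply/existsP; exists v; apply: undominated_legal.
by rewrite dominatedU1 /dominated big_set0 setU0.
Qed.

End Moves.

Section Cliques.
Variable G : sgraph.
Hypothesis trG : nbh_transitive G.
Implicit Types (S D : {set G}) (p : player) (u v : G).

(** Membership in closed neighborhoods is now an equivalence relation, and its classes are the
    cliques. *)
Lemma eq_closed_nbh u v : (closed_nbh u == closed_nbh v) = (u \in closed_nbh v).
Proof.
apply/eqP/idP => [<-|uv]; first exact: closed_nbh_refl.
have vu : v \in closed_nbh u by rewrite closed_nbh_sym.
by apply/setP=> w; apply/idP/idP; apply: trG.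
Qed.

(** If some [w] in [S] dominates [v], transitivity makes it dominate all neighbors of [v] too, so
    [v] gains nothing. *)
Lemma legal_undominated S v : legal S v = (v \notin dominated S).
Proof.
apply/idP/idP => [/subsetPn[u uv]|]; last exact: undominated_legal.
apply: contra => /dominatedP[w wS wv]; apply/dominatedP.
by exists w => //; apply: trG uv.
Qed.

(** A clique is represented by the closed neighborhood that its vertices share, so the image counts
    it once. *)
Definition undominated_cliques S : {set {set G}} :=
  (@closed_nbh G) @: ~: dominated S.

Lemma undominated_cliquesU1 v S :
  undominated_cliques (v |: S) = undominated_cliques S :\ closed_nbh v.
Proof.
apply/setP=> C; rewrite in_setD1; apply/imsetP/andP => [[u]|[Cv /imsetP[u uS Cu]]].
  rewrite dominatedU1 !in_setC in_setU negb_or => /andP[uv uS] ->.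
  by rewrite eq_closed_nbh uv imset_f ?in_setC.
exists u => //; rewrite dominatedU1 in_setC in_setU negb_or.
by rewrite -eq_closed_nbh -Cu Cv -in_setC.
Qed.

Lemma moves_left_cliques p S : moves_left p S = #|undominated_cliques S|.
Proof.
move def_k: #|undominated_cliques S| => k.
elim: k p S def_k => [|k IHk] p S def_k.
  rewrite moves_leftE ifF //; apply/existsP => -[v].
  rewrite legal_undominated -in_setC => vS; move/eqP: def_k.
  by rewrite cards_eq0 => /eqP/setP/(_ (closed_nbh v)); rewrite in_set0 imset_f.
have /card_gt0P[_ /imsetP[v vS _]] : 0 < #|undominated_cliques S| by rewrite def_k.
(* There are at most as many cliques as vertices. *)
have kG : k <= #|G|.
  rewrite ltnW // -def_k.
  exact: leq_trans (leq_imset_card _ _) (max_card _).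
apply: (@moves_left_const _ _ _ v) => // [|u]; rewrite legal_undominated -in_setC //.
move=> uS; apply: IHk; apply/eqP; rewrite -eqSS -def_k undominated_cliquesU1.
by rewrite [eqbRHS](cardsD1 (closed_nbh u)) imset_f.
Qed.

Lemma gamma_cliques : gamma G = #|undominated_cliques set0|.
Proof.
have all_undominated v : v \in ~: dominated set0.
  by rewrite in_setC /dominated big_set0 in_set0.
apply/eqP; rewrite eqn_leq; apply/andP; split; last first.
  (* A dominating set meets every clique, so its closed neighborhoods exhaust the cliques. *)
  have [D /eqP domD ->] := gamma_attained G.
  apply: leq_trans (leq_imset_card (@closed_nbh G) _).
  apply/subset_leq_card/subsetP => _ /imsetP[v _ ->].
  have: v \in dominated D by rewrite domD inE.
  case/dominatedP=> u uD uv; apply/imsetP; exists u => //.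
  by apply/eqP; rewrite eq_closed_nbh.
have [v0 _|G0] := pickP G; last first.
  apply: leq_trans (gamma_le (@dominating_setT G)) _.
  by rewrite cardsT (eq_card0 G0).
(* One representative per clique dominates. The default [v0] is never taken on a closed
   neighborhood, which contains its own center. *)
pose rep (C : {set G}) := odflt v0 [pick v in C].
apply: leq_trans (leq_imset_card rep _); apply: gamma_le.
apply/eqP/setP=> v; rewrite in_setT; apply/dominatedP.
exists (rep (closed_nbh v)); first by rewrite !imset_f.
rewrite closed_nbh_sym /rep; case: pickP => //= /(_ v).
by rewrite closed_nbh_refl.
Qed.

Lemma gamma_g'_eq_gamma : gamma_g' G = gamma G.
Proof. by rewrite gamma_cliques; apply: moves_left_cliques. Qed.

End Cliques.

Lemma perfect_nbh_transitive (G : sgraph) :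
  gamma_g'_perfect G -> nbh_transitive G.
Proof.
move=> perfG u v w uv vw; apply/negPn/negP => uw.
(* By [uw] the three vertices are distinct and induce a path with middle vertex [v]. *)
pose A := [set u; v; w].
have uA : u \in A by rewrite !inE eqxx.
have vA : v \in A by rewrite !inE eqxx orbT.
have wA : w \in A by rewrite !inE eqxx orbT.
have A0 : A != set0 by apply/set0Pn; exists u.
pose u' : induced A := exist _ u uA.
pose v' : induced A := exist _ v vA.
pose w' : induced A := exist _ w wA.
have := @gamma_g'_gt1 (induced A) u' w'; rewrite induced_closed_nbh perfG //.
(* The bound 1 is read as the size of [[set v']], so it remains to see that [v'] alone dominates. *)
move/(_ uw); apply/negP; rewrite -leqNgt -(cards1 v').
apply/gamma_le/eqP/setP => x; rewrite in_setT; apply/dominatedP.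
exists v'; rewrite ?set11 // induced_closed_nbh.
have /setUP[/set2P[]|/set1P] := valP x; move=> -> //=.
  by rewrite closed_nbh_sym.
exact: closed_nbh_refl.
Qed.

Theorem proposition5p1 (G : sgraph) (G_nonempty : 0 < #|G|) :
  gamma_g'_perfect G <-> disjoint_union_of_cliques G.
Proof.
split=> [/perfect_nbh_transitive/nbh_transitiveP // | /nbh_transitiveP trG A _].
exact/gamma_g'_eq_gamma/induced_nbh_transitive.
Qed.
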